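(* Let $p$ be a prime and let $G$ be a quasihamiltonian $p$-group. Then $G$ is an FC-group if and only if its derived subgroup $G'$ is finite.
   Context: A group $G$ is quasihamiltonian if $XY=YX$ for every pair of subgroups $X,Y$ of $G$. A (possibly infinite) group is a $p$-group if every element has order a power of $p$. A group is an FC-group if every element has only finitely many conjugates. $G'$ is the subgroup generated by all commutators $[a,b]=aba^{-1}b^{-1}$. *)

(* Defs.v *)
From mathcomp Require Import all_boot.
From mathcomp Require Import boolp classical_sets cardinality.

Set Implicit Arguments.
Unset Strict Implicit.
Unset Printing Implicit Defensive.

Local Open Scope group_scope.
Local Open Scope classical_set_scope.

Definition subgroup (G : groupType) (X : set G) : Prop := group_closed [in X].

Definition prodset (G : groupType) (X Y : set G) : set G :=
  [set x * y | x in X & y in Y].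

Definition quasihamiltonian (G : groupType) : Prop :=
  forall X Y : set G, subgroup X -> subgroup Y -> prodset X Y = prodset Y X.

Definition has_order (G : groupType) (x : G) (n : nat) : Prop :=
  [/\ (0 < n)%N, x ^+ n = 1
    & forall m : nat, (0 < m)%N -> x ^+ m = 1 -> (n <= m)%N].

Definition p_group (p : nat) (G : groupType) : Prop :=
  forall x : G, exists k : nat, has_order x (p ^ k)%N.

(* x ^ g is g^-1 * x * g. *)
Definition FC_group (G : groupType) : Prop :=
  forall x : G, finite_set [set x ^ g | g in [set: G]].

(* Commutators are a b a^-1 b^-1, unlike MathComp's
   [~ a, b] = a^-1 b^-1 a b. *)
Definition derived (G : groupType) : set G :=
  smallest (@subgroup G)
    [set a * b * a^-1 * b^-1 | a in [set: G] & b in [set: G]].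

Arguments derived : clear implicits.

(* Main.v *)
Require Import Defs.
From mathcomp Require Import all_boot.
From mathcomp Require Import boolp classical_sets cardinality.

(** If the derived subgroup is finite, then the conjugates of [x] lie in finitely
many elements of the form [d * x].

Conversely let [G] be FC.  Since cyclic subgroups permute and are finite, finitely
many elements generate a finite subgroup; so it suffices to show that there are
finitely many commutators.  For each [e], two things are compared: the set of
elements killed by [p ^ e], and how large the orders of elements centralizing a
finite set can be, modulo that set.

The heart of the matter is [torsion_commutes_step].  Suppose that for all finite
[F] some [y] centralizing [F] has [y ^+ (p ^ e)] outside [F].  Then any two elements
[x], [x'] killed by [q = p ^ e.+1] commute.  Indeed, choose [y] commuting with both,
of order at least [q] modulo the group they generate.  The pairs
[x * y ^+ s], [x' * y ^+ t] all have the same commutator [c], and permutability gives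
[c = x' ^+ j * x ^+ i * y ^+ (s * i + t * j)] with [q] dividing [s * i + t * j].  If
[(s, t)] is [(1, 0)] or [(0, 1)], one of the first two factors is trivial, so that
[c], up to a power of [y ^+ q], is a power of [x'] and also of [x]; thus [c] is
central.  Unless it shows that [x] and [x'] commute or that [c] is a power of
[y ^+ q], each relation then produces an element [g], a product of powers of [x]
and [x'], such that some [p ^ u]-th power of [g] is a power of [y ^+ q].  Dividing
[g] by a power of [y] gives an element of order at most [p ^ u], smaller than the
order of [x] or of [x'], which by induction on the orders commutes with [x'] or with
[x], and so does [x] or [x'].  When [c] is a power of [y ^+ q], the relation with
[(s, t) = (0, 0)] is of this kind.

If the supposition fails for some [e] while elements killed by [p ^ e] commute, then
the centralizer of some finite set has only finitely many [p ^ e]-th powers.  Two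
commuting elements with the same [p ^ e]-th power differ by an element killed by
[p ^ e], so [centralizer_cover] shows that [G] is covered by finitely many
translates of the set of elements killed by [p ^ e], whose elements commute; this
leaves finitely many commutators.  If it never fails, [G] is abelian. *)

Set Implicit Arguments.
Unset Strict Implicit.
Unset Printing Implicit Defensive.

Local Open Scope group_scope.
Local Open Scope classical_set_scope.

(** * Subgroups and products of subgroups *)

Lemma subgroupP (G : groupType) (X : set G) :
  subgroup X <-> X 1 /\ (forall x y, X x -> X y -> X (x / y)).
Proof.
split=> [[X1 XD]|[X1 XD]]; split.
- by move: X1; rewrite inE.
- by move=> x y Xx Xy; have := XD x y; rewrite !inE; apply.
- by rewrite inE.
- by move=> x y; rewrite !inE; apply: XD.
Qed.

Lemma subgroupV (G : groupType) (X : set G) x : subgroup X -> X x -> X x^-1.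
Proof. by move=> /subgroupP[X1 XD] Xx; rewrite -[x^-1]mul1g; apply: XD. Qed.

Lemma subgroupM (G : groupType) (X : set G) x y :
  subgroup X -> X x -> X y -> X (x * y).
Proof.
move=> sX Xx Xy; rewrite -[y]invgK.
by have /subgroupP[_] := sX; apply=> //; apply: subgroupV.
Qed.

Lemma subgroupX (G : groupType) (X : set G) x n :
  subgroup X -> X x -> X (x ^+ n).
Proof.
move=> sX Xx; elim: n => [|n IHn]; first by rewrite expg0; case/subgroupP: sX.
by rewrite expgS; apply: subgroupM.
Qed.

Lemma prodset_subgroup (G : groupType) (X Y : set G) :
  subgroup X -> subgroup Y -> prodset X Y = prodset Y X ->
  subgroup (prodset X Y).
Proof.
move=> sX sY XY; have [X1 _] := (subgroupP X).1 sX.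
have [Y1 _] := (subgroupP Y).1 sY.
apply/subgroupP; split; first by exists 1 => //; exists 1 => //; rewrite mulg1.
move=> _ _ [a Xa [b Yb <-]] [c Xc [d Yd <-]].
have [c' Xc' [b' Yb' e]] : prodset X Y ((b / d) * c^-1).
  rewrite XY; exists (b / d); first by apply: subgroupM => //; apply: subgroupV.
  by exists c^-1 => //; apply: subgroupV.
exists (a * c'); first exact: subgroupM.
by exists b' => //; rewrite -mulgA e invgM !mulgA.
Qed.

Definition powers (G : groupType) (x : G) : set G := range (fun n => x ^+ n).

Lemma powers_id (G : groupType) (x : G) : powers x x.
Proof. by exists 1%N. Qed.

(** * Powers when commutators are central *)

Lemma commutator_expg (G : groupType) (g h c : G) n :
  commute c g -> g * h = h * g * c -> g ^+ n * h = h * g ^+ n * c ^+ n.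
Proof.
move=> cg e; elim: n => [|n IHn]; first by rewrite !expg0 !mulg1 mul1g.
rewrite expgS -mulgA IHn !mulgA e -!mulgA; congr (h * (g * _)).
by rewrite (expgS c) !mulgA; congr (_ * _); exact: commuteX.
Qed.

Lemma expgMn_central (G : groupType) (g h c : G) n :
  commute c g -> commute c h -> g * h = h * g * c ->
  exists k, (h * g) ^+ n = h ^+ n * g ^+ n * c ^+ k.
Proof.
move=> cg ch e; elim: n => [|n [k IHn]].
  by exists 0; rewrite !expg0 !mulg1.
have e' : h * g = g * h * c^-1 by rewrite e mulgK.
have ceh := commutator_expg n (commute_sym (commuteV (commute_sym ch))) e'.
have gh : g * h ^+ n = h ^+ n * g * c ^+ n.
  by rewrite ceh expVgn mulgVK.
exists (n + k)%N; rewrite expgS IHn !mulgA -(mulgA h g) gh !expgS expgnDr.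
rewrite -!mulgA; do 3!congr (_ * _).
by rewrite !mulgA; congr (_ * _); apply: commuteX2.
Qed.

(** * FC-groups and centralizers of finite sets *)

Definition centralizes (G : groupType) (y : G) (F : seq G) : Prop :=
  {in F, forall x, commute x y}.

(** The finite set [F] has finitely many images under simultaneous conjugation;
elements with the same image differ by an element of the centralizer. *)
Lemma fc_transversal (G : groupType) (F : seq G) : FC_group G -> exists T : seq G,
  forall g, exists2 t, t \in T & centralizes (t^-1 * g) F.
Proof.
move=> hfc; pose f (g : G) := [seq x ^ g^-1 | x <- F].
have fin : finite_set (range f).
  rewrite {}/f; elim: F => [|x F IHF] /=; first exact: finite_image_cst.
  apply: (sub_finite_set _ (finite_image2 cons (hfc x) IHF)) => _ [g _ <-].
  exists (x ^ g^-1); first by exists g^-1.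
  by exists [seq z ^ g^-1 | z <- F] => //; exists g.
have [s es] := (finite_seqP _).1 fin.
have sub : {subset s <= range f} by move=> z zs; rewrite inE es.
have [T hT] : exists T : seq G, {in s, forall z, exists2 t, t \in T & f t = z}.
  elim: s {es} sub => [|z s IHs] sub; first by exists [::].
  have [|T hT] := IHs; first by move=> w ws; apply: sub; rewrite inE ws orbT.
  have := sub z (mem_head _ _); rewrite inE => -[t _ ft].
  exists (t :: T) => w; rewrite inE => /orP[/eqP->|/hT[u uT fu]].
    by exists t => //; apply: mem_head.
  by exists u => //; rewrite inE uT orbT.
exists T => g; have [|t tT ft] := hT (f g).
  have : range f (f g) by exists g.
  by rewrite es.
exists t => // x xF; have /eq_in_map/(_ x xF) e := ft.
by apply/commgP/conjg_fixP; rewrite conjgM e conjgKV.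
Qed.

(** Each step centralizes one more element [y] with [y ^+ q = w].  An element [z]
of the new centralizer with [z ^+ q = w] then commutes with [y], so that
[(y^-1 * z) ^+ q = 1], and [w] can be struck off the list [W] of [q]-th powers
still to be dealt with. *)
Lemma centralizer_cover (G : groupType) q (W : seq G) : forall F T : seq G,
    (forall y, centralizes y F ->
       y ^+ q \in W \/ exists2 t, t \in T & (t^-1 * y) ^+ q = 1) ->
  exists F' T' : seq G, forall y, centralizes y F' ->
    exists2 t, t \in T' & (t^-1 * y) ^+ q = 1.
Proof.
elim: W => [|w W IHW] F T cov.
  by exists F, T => y /cov[].
have [[y yF yw]|noy] := EM (exists2 y, centralizes y F & y ^+ q = w).
  apply: (IHW (y :: F) (y :: T)) => z zyF.
  have zF : centralizes z F by move=> x xF; apply: zyF; rewrite inE xF orbT.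
  have yz : commute y z by apply/zyF/mem_head.
  have [|[t tT tz]] := cov z zF; last first.
    by right; exists t => //; rewrite inE tT orbT.
  rewrite inE => /orP[/eqP zw|]; last by left.
  right; exists y; first exact: mem_head.
  rewrite expgMn; last exact/commute_sym/commuteV/commute_sym.
  by rewrite expVgn yw zw mulVg.
apply: (IHW F T) => z zF; have [|] := cov z zF; last by right.
by rewrite inE => /orP[/eqP zw|]; [case: noy; exists z | left].
Qed.

Lemma FC_of_derived_finite (G : groupType) : finite_set (derived G) -> FC_group G.
Proof.
move=> fin x; apply: sub_finite_set (finite_image (fun d => d * x) fin).
move=> _ [g _ <-]; exists (g^-1 * x * g * x^-1); last by rewrite mulgVK conjgE mulgA.
by apply: sub_gen_smallest; exists g^-1 => //; exists x; rewrite ?invgK.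
Qed.

(** * Torsion and permutability of cyclic subgroups *)

Section PGroup.
Context (p : nat) (G : groupType).
Hypotheses (p_pr : prime p) (hq : quasihamiltonian G) (hp : p_group p G).

Lemma expg_pow_eq1 (x : G) : exists k, x ^+ (p ^ k.+1) = 1.
Proof.
have [k [_ xk _]] := hp x; exists k.
by rewrite expnSr expgnA xk expg1n.
Qed.

Lemma powers_subgroup (x : G) : subgroup (powers x).
Proof.
have [k xk] := expg_pow_eq1 x.
have k0 : (0 < p ^ k.+1)%N by rewrite expn_gt0 prime_gt0.
apply/subgroupP; split; first by exists 0.
move=> _ _ [m _ <-] [n _ <-]; exists (m + (p ^ k.+1).-1 * n)%N => //=.
rewrite expgnDr; congr (_ * _); apply: (mulIg (x ^+ n)).
rewrite mulVg expgnA -expgMn; last exact/commute_sym/commuteX.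
by rewrite -expgSr prednK // xk expg1n.
Qed.

(** Coprimality of [k] with [p] lets exponents be inverted and later used as
multipliers modulo [p]. *)
Lemma expg_coprime_root (x : G) i : coprime p i ->
  exists2 k, coprime p k & x ^+ (i * k) = x.
Proof.
move=> cpi; have [k xk] := expg_pow_eq1 x.
have i0 : (0 < i)%N.
  by rewrite lt0n; apply: contraL cpi => /eqP->; rewrite prime_coprime // dvdn0.
have [u v def_u _] := egcdnP (p ^ k.+1)%N i0.
have ci : gcdn i (p ^ k.+1) = 1%N.
  by apply/eqP; rewrite -/(coprime _ _) coprime_sym coprimeXl.
rewrite ci in def_u; exists u.
  rewrite prime_coprime //; apply/negP => pu.
  have := dvdn_mulr i pu; rewrite def_u dvdn_addr ?Euclid_dvd1 //.
  by rewrite expnS mulnCA dvdn_mulr.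
by rewrite mulnC def_u expgnDr mulnC expgnA xk expg1n mul1g.
Qed.

Lemma commute_coprime_root (x z : G) i :
  coprime p i -> commute (x ^+ i) z -> commute x z.
Proof.
move=> /(expg_coprime_root x)[k _ xk] xz; rewrite -xk expgnA.
exact/commute_sym/commuteX/commute_sym.
Qed.

(** Permutability of the cyclic groups of [g] and [h] puts [g * h] in the shape
[h ^+ j' * g ^+ i'], and the factors [h^-1] and [g^-1] only change the exponents.  Positivity of the exponents makes their [p]-adic valuations
meaningful. *)
Lemma quasi_commutator (g h : G) : exists i j,
  [/\ (0 < i)%N, (0 < j)%N & h^-1 * g * h / g = h ^+ j * g ^+ i].
Proof.
have [_ [j _ <-] [_ [i _ <-] e]] : prodset (powers h) (powers g) (g * h).
  rewrite hq; [|exact: powers_subgroup..].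
  by exists g; [exact: powers_id | exists h => //; apply: powers_id].
have pos (x z : G) : powers x z -> exists2 m, (0 < m)%N & z = x ^+ m.
  move=> [m _ <-]; have [k xk] := expg_pow_eq1 x; exists (m + p ^ k.+1)%N.
    by rewrite ltn_addl // expn_gt0 prime_gt0.
  by rewrite expgnDr xk mulg1.
have [|i' i0 ei] := pos g (g ^+ i / g).
  apply: subgroupM; [exact: powers_subgroup | by exists i |].
  by apply: subgroupV; [exact: powers_subgroup | exact: powers_id].
have [|j' j0 ej] := pos h (h^-1 * h ^+ j).
  apply: subgroupM; [exact: powers_subgroup | | by exists j].
  by apply: subgroupV; [exact: powers_subgroup | exact: powers_id].
exists i', j'; split=> //.
by rewrite -ei -ej -(mulgA _ g h) -e !mulgA.
Qed.

(** * Commutation through a nearly independent commuting element *)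

(** The element [y] commutes with the pair under study; [q] bounds the orders of
the elements of the pair. *)
Section Adjust.
Variables (e : nat) (y : G).
Local Notation q := (p ^ e.+1)%N.

(** The cyclic group generated by [y ^+ q]. *)
Definition in_span (z : G) : Prop := powers (y ^+ q) z.

Lemma in_span_subgroup : subgroup in_span.
Proof. exact: powers_subgroup. Qed.

Lemma in_span_commute (z g : G) : in_span z -> commute g y -> commute g z.
Proof. by move=> [n _ <-] gy; do 2!apply: commuteX. Qed.

Lemma in_span_exp m : q %| m -> in_span (y ^+ m).
Proof. by move=> /dvdnP[n ->]; exists n => //; rewrite mulnC expgnA. Qed.

(** An element of the span is the [p ^ u]-th power of a power of [y].  Dividing
[g] by that power of [y] gives an element killed by [p ^ u], which commutes with
[x] by the induction hypothesis, and the correction factor commutes with [x]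
too. *)
Lemma commute_of_root (x g : G) a u :
    (forall h, h ^+ (p ^ a) = 1 -> commute h x) ->
    commute x y -> commute g y -> (u <= a <= e)%N ->
  in_span (g ^+ (p ^ u)) -> commute g x.
Proof.
move=> IH xy gy /andP[ua ae] [n _ gu].
pose d := (p ^ (e.+1 - u) * n)%N.
have hu : (g / y ^+ d) ^+ (p ^ u) = 1.
  rewrite expgnFl; last exact: commuteX.
  rewrite -gu -!expgnA /d mulnAC -expnD subnK ?mulgV //.
  exact: leq_trans ua (leqW ae).
have /commute_sym hx : commute (g / y ^+ d) x.
  by apply: IH; rewrite -(subnKC ua) expnD expgnA hu expg1n.
rewrite -[g](mulgVK (y ^+ d)); apply/commute_sym/commuteM => //.
exact: commuteX.
Qed.

Section Pair.
Variables (x x' : G).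
Hypotheses (xy : commute x y) (x'y : commute x' y).

(** The exponent [B * p ^ t] of [x'] is a multiple of [p ^ u], so the product in
the span is, up to a power of [c], the [p ^ u]-th power of
[x' ^+ (B * p ^ (t - u)) * x ^+ A]; this element commutes with [x'] by
[commute_of_root]. *)
Lemma commute_of_span_product c a A B u t :
    (forall h, h ^+ (p ^ a) = 1 -> commute h x') -> (a <= e)%N ->
    x * x' = x' * x * c -> in_span c ->
    in_span (x' ^+ (B * p ^ t) * x ^+ (A * p ^ u)) ->
    coprime p A -> (u <= t)%N -> (u <= a)%N ->
  commute x x'.
Proof.
move=> IH ae xx' cY zY cA ut ua.
set h := x' ^+ (B * p ^ (t - u)); set g := x ^+ A.
have cx z : commute z y -> commute c z.
  by move=> zy; apply/commute_sym/in_span_commute.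
have gx' : g * x' = x' * g * c ^+ A by apply: commutator_expg => //; apply: cx.
have gh : g * h = h * g * (c ^+ A) ^+ (B * p ^ (t - u)).
  have e1 : x' * g = g * x' * (c ^+ A)^-1 by rewrite gx' mulgK.
  have cAx' : commute (c ^+ A)^-1 x'.
    by apply/commute_sym/commuteV/commuteX/commute_sym/cx.
  by rewrite /h (commutator_expg _ cAx' e1) expVgn mulgVK.
have hy : commute h y by apply/commute_sym/commuteX/commute_sym.
have gy : commute g y by apply/commute_sym/commuteX/commute_sym.
set c' := (c ^+ A) ^+ _ in gh.
have cc' z : commute z y -> commute c' z.
  move=> /cx /commute_sym cz; apply/commute_sym; rewrite /c'.
  by do 2!apply: commuteX.
have [k ek] := expgMn_central (p ^ u) (cc' _ gy) (cc' _ hy) gh.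
have c'Y : in_span c'.
  by do 2!(apply: subgroupX; first exact: in_span_subgroup).
have hgx' : commute (h * g) x'.
  apply: (commute_of_root IH x'y (u := u)); last 2 first.
  - by rewrite ua.
  - rewrite ek -!expgnA -mulnA -expnD subnK //.
    apply: subgroupM => //; first exact: in_span_subgroup.
    by apply: subgroupX => //; exact: in_span_subgroup.
  - by apply/commute_sym/commuteM; apply/commute_sym.
apply: (commute_coprime_root (i := A)) => //; rewrite -/g.
rewrite -[g](mulKg h); apply/commute_sym/commuteM; last exact/commute_sym.
by apply/commuteV/commuteX.
Qed.

End Pair.

(** As [u < t], the element [x' ^+ (B * p ^ (t - u))] is a power of [x' ^+ p] and
commutes with [x]; so dividing [x ^+ A] by it gives a [p ^ u]-th root of [z]. *)
Lemma commute_of_span_ratio (x x' z : G) a A B u t :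
    (forall h, h ^+ (p ^ a) = 1 -> commute h x') -> (a <= e)%N ->
    commute x y -> commute x' y -> commute (x' ^+ p) x ->
    x ^+ (A * p ^ u) = x' ^+ (B * p ^ t) * z -> in_span z ->
    coprime p A -> (u < t)%N -> (u <= a)%N ->
  commute x x'.
Proof.
move=> IH ae xy x'y x'px xx' zY cA ut ua.
set w := x' ^+ (B * p ^ (t - u)).
have xw : commute x w.
  rewrite /w -[(t - u)%N](@subnK 1) ?subn_gt0 // addn1 expnSr mulnA.
  by rewrite mulnC expgnA; apply/commuteX/commute_sym.
have gw : commute (x ^+ A) w by apply/commute_sym/commuteX/commute_sym.
have wy : commute w y by apply/commute_sym/commuteX/commute_sym.
have gx' : commute (x ^+ A / w) x'.
  apply: (commute_of_root IH x'y (u := u)); last 2 first.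
  - by rewrite ua.
  - rewrite expgnFl // /w -!expgnA -mulnA -expnD subnK ?(ltnW ut) // xx'.
    have x'z := in_span_commute zY x'y.
    have -> : x' ^+ (B * p ^ t) * z = z * x' ^+ (B * p ^ t).
      exact/commute_sym/commuteX/commute_sym.
    by rewrite mulgK.
  - by apply/commute_sym/commuteM; [|apply: commuteV]; do ?apply: commuteX;
      apply/commute_sym.
apply: (commute_coprime_root (i := A)) => //.
rewrite -[x ^+ A](mulgVK w); apply/commute_sym/commuteM; first exact/commute_sym.
exact: commuteX.
Qed.

(** If the commutator [c] lies in the span, then the permutability relation
[c = x' ^+ j * x ^+ i] shows that a product of powers of [x'] and [x] lies in the
span, and [commute_of_span_product] applies with the smaller of the two [p]-adic
valuations of [i] and [j].  A power that is trivial is left out first, since its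
valuation exceeds the range covered by the induction hypothesis. *)
Lemma commute_of_span_commutator (x x' c : G) a b i j :
    (forall h, h ^+ (p ^ a) = 1 -> commute h x') -> (a <= e)%N ->
    (forall h, h ^+ (p ^ b) = 1 -> commute h x) -> (b <= e)%N ->
    x ^+ (p ^ a.+1) = 1 -> x' ^+ (p ^ b.+1) = 1 ->
    commute x y -> commute x' y -> x * x' = x' * x * c -> in_span c ->
    (0 < i)%N -> (0 < j)%N -> c = x' ^+ j * x ^+ i ->
  commute x x'.
Proof.
move=> IH ae IH' be xa x'b xy x'y xx' cY i0 j0 ec.
have cx z : commute z y -> commute c z.
  by move=> zy; apply/commute_sym/in_span_commute.
have [A cA eA] := pfactor_coprime p_pr i0.
have [B cB eB] := pfactor_coprime p_pr j0.
set u := logn p i in eA; set t := logn p j in eB.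
have x'x : x' * x = x * x' * c^-1 by rewrite xx' mulgK.
have cVY : in_span c^-1 by apply: subgroupV => //; apply: in_span_subgroup.
have ec' : c = x ^+ i * x' ^+ j.
  apply: (mulgI (x' ^+ j)); rewrite mulgA -ec.
  exact/commute_sym/commuteX/cx.
have [ua|au] := leqP u a; have [tb|bt] := leqP t b.
- have [ut|tu] := leqP u t.
    apply: (commute_of_span_product xy x'y IH ae xx' cY _ cA ut ua (B := B)).
    by rewrite -eA -eB -ec.
  apply/commute_sym.
  apply: (commute_of_span_product x'y xy IH' be x'x cVY _ cB (ltnW tu) tb (B := A)).
  by rewrite -eA -eB -ec'.
- have x'j : x' ^+ j = 1.
    by rewrite eB -(subnK bt) expnD mulnA mulnC expgnA x'b expg1n.
  apply: (commute_of_span_product xy x'y IH ae xx' cY _ cA (leqnn u) ua (B := 0)).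
  by rewrite mul0n expg0 mul1g -eA -[x ^+ i]mul1g -x'j -ec.
- have xi : x ^+ i = 1 by rewrite eA -(subnK au) expnD mulnA mulnC expgnA xa expg1n.
  apply/commute_sym.
  apply: (commute_of_span_product x'y xy IH' be x'x cVY _ cB (leqnn t) tb (B := 0)).
  by rewrite mul0n expg0 mul1g -eB -[x' ^+ j]mulg1 -xi -ec.
- have x'j : x' ^+ j = 1.
    by rewrite eB -(subnK bt) expnD mulnA mulnC expgnA x'b expg1n.
  have xi : x ^+ i = 1 by rewrite eA -(subnK au) expnD mulnA mulnC expgnA xa expg1n.
  by rewrite /commute xx' ec xi x'j !mulg1.
Qed.

(** The order of [y] modulo the group generated by [x] and [x'] is at least
[q]: for a [p]-element this amounts to [y ^+ (p ^ e)] being outside that group. *)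
Definition span_pure (x x' : G) : Prop :=
  forall m, prodset (powers x') (powers x) (y ^+ m) -> q %| m.

(** Multiplying [x] and [x'] by powers of [y] leaves their commutator unchanged,
but [quasi_commutator] gives a new relation for each choice of [s] and [t]. *)
Lemma perturbed_commutator (x x' : G) s t :
    commute x y -> commute x' y -> span_pure x x' -> exists i j,
  [/\ (0 < i)%N, (0 < j)%N, q %| s * i + t * j
    & x'^-1 * x * x' / x = x' ^+ j * x ^+ i * y ^+ (s * i + t * j)].
Proof.
move=> xy x'y pure.
have [i [j [i0 j0 eij]]] := quasi_commutator (x * y ^+ s) (x' * y ^+ t).
have fixC (g h : G) : commute g h -> g ^ h = g.
  by move=> gh; rewrite conjgE gh mulKg.
have ec : x'^-1 * x * x' / x = x' ^+ j * x ^+ i * y ^+ (s * i + t * j).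
  transitivity ((x' * y ^+ t)^-1 * (x * y ^+ s) * (x' * y ^+ t) / (x * y ^+ s)).
    have conjE (g h : G) : g^-1 * h * g = h ^ g by rewrite conjgE mulgA.
    rewrite !conjE conjMg conjgM.
    rewrite (fixC (x ^ x') (y ^+ t)); last first.
      by apply/commuteX/commute_sym; rewrite conjgE;
        do 2?apply: commuteM; do 1?apply: commuteV; apply: commute_sym.
    rewrite (fixC (y ^+ s)); last first.
      apply/commuteM; first exact/commute_sym/commuteX.
      exact: commuteX2.
    by rewrite invgM !mulgA mulgK conjgE !mulgA.
  rewrite eij !expgMn; [|exact: commuteX..].
  rewrite -!expgnA -!mulgA; congr (_ * _).
  rewrite addnC expgnDr !mulgA; congr (_ * _).
  exact/commuteX2/commute_sym.
exists i, j; split=> //; apply: pure.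
have sx := powers_subgroup x; have sx' := powers_subgroup x'.
have sP := prodset_subgroup sx' sx (hq sx' sx).
have [x1 _] := (subgroupP _).1 sx; have [x'1 _] := (subgroupP _).1 sx'.
have Px : prodset (powers x') (powers x) x.
  by exists 1 => //; exists x; rewrite ?mul1g //; apply: powers_id.
have Px' : prodset (powers x') (powers x) x'.
  by exists x'; [exact: powers_id | exists 1; rewrite ?mulg1].
rewrite -[y ^+ _](mulKg (x' ^+ j * x ^+ i)) -ec.
apply: subgroupM => //.
  by apply: subgroupV => //; apply: subgroupM => //; apply: subgroupX.
by do 3?[apply: subgroupM => //]; apply: subgroupV.
Qed.

(** Modulo the span, [x ^+ (p ^ u)] and [x' ^+ (p ^ u)] are the powers [c ^+ m] and
[c ^+ n] of a central element of order dividing [p].  Perturbing by [y ^+ m] and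
[y ^+ n] gives exponents with [q %| m * i + n * j].  If [p ^ u] divides both,
then modulo the span [c = c ^+ ((m * i + n * j) %/ p ^ u)], and the exponent is
divisible by [p], so [c] lies in the span.  Otherwise [i] and [j] share a
smaller power [p ^ v], and the product of the [p ^ v]-th roots of [x' ^+ j] and
[x ^+ i] has its [p ^ v.+1]-th power in the span.  The case of quaternion groups
is the reason why the ratio of the roots of [x ^+ (p ^ u)] and [x' ^+ (p ^ u)]
alone does not suffice. *)
Lemma commute_of_equal_heights (x x' c z z' : G) a u m n :
    (forall h, h ^+ (p ^ a) = 1 -> commute h x') -> (u <= a <= e)%N ->
    commute x y -> commute x' y -> span_pure x x' ->
    c = x'^-1 * x * x' / x -> commute c x -> commute c x' -> commute c y ->
    x * x' = x' * x * c -> c ^+ p = 1 ->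
    x ^+ (p ^ u) = c ^+ m * z -> in_span z -> coprime p m ->
    x' ^+ (p ^ u) = c ^+ n * z' -> in_span z' -> coprime p n ->
  commute x x' \/ in_span c.
Proof.
move=> IH uae xy x'y pure ec cx cx' cy xx' cp hx zY pm hx' z'Y pn.
have [ua ae] := andP uae.
have [i [j [i0 j0 qM]]] := perturbed_commutator m n xy x'y pure.
rewrite -ec; set M := (m * i + n * j)%N in qM * => eM.
have dvdj d : (d <= e.+1)%N -> p ^ d %| i -> p ^ d %| j.
  move=> de di; have : p ^ d %| M by apply: dvdn_trans qM; apply: dvdn_exp2l.
  rewrite dvdn_addr; last exact: dvdn_mull.
  by rewrite Gauss_dvdr // coprimeXl.
have MY : in_span (y ^+ M) by apply: in_span_exp.
have spanM g h : in_span g -> in_span h -> in_span (g * h).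
  exact: subgroupM in_span_subgroup.
have spanX g k : in_span g -> in_span (g ^+ k).
  exact: subgroupX in_span_subgroup.
have [A cA] := pfactor_coprime p_pr i0; set v := logn p i => eA.
have [uv|vu] := leqP u v.
  (* Here [M = p ^ u * (n * j1 + m * i1)] is divisible by [p ^ u.+1]. *)
  right.
  have di : p ^ u %| i by rewrite eA dvdn_mull // dvdn_exp2l.
  have /dvdnP[j1 ej] := dvdj u (leq_trans ua (leqW ae)) di.
  have /dvdnP[i1 ei] := di.
  have /dvdnP[k ek] : p %| n * j1 + m * i1.
    rewrite -(@dvdn_pmul2l (p ^ u)) ?expn_gt0 ?prime_gt0 // -expnSr.
    have -> : (p ^ u * (n * j1 + m * i1) = M)%N.
      by rewrite mulnDr addnC mulnCA (mulnCA (p ^ u)%N) !(mulnC (p ^ u)%N) -ei -ej.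
    by apply: dvdn_trans qM; rewrite dvdn_exp2l // ltnS (leq_trans ua).
  have cspan g : in_span g -> commute g c.
    by move=> gY; apply/commute_sym/in_span_commute.
  rewrite eM ei ej !(mulnC _ (p ^ u)%N) !expgnA hx hx'.
  have -> : (c ^+ n * z') ^+ j1 * (c ^+ m * z) ^+ i1 = z' ^+ j1 * z ^+ i1.
    rewrite !expgMn; [|exact/commute_sym/commuteX/cspan..].
    have cz' : commute (c ^+ n ^+ j1) (z' ^+ j1).
      by apply/commute_sym; do 2!apply: commuteX; apply/cspan/spanX.
    rewrite cz' -!mulgA; congr (_ * _); rewrite mulgA -!expgnA -expgnDr ek.
    by rewrite mulnC expgnA cp expg1n mul1g.
  by do 2?apply: (spanM) => //; apply: spanX.
(* The factor [y ^+ M] is in the span, and [c] dies in the [p]-th power. *)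
left.
have di : p ^ v %| i by rewrite eA dvdn_mull.
have /dvdnP[j1 ej] := dvdj v (leq_trans (ltnW vu) (leq_trans ua (leqW ae))) di.
have xA : x ^+ A * x' = x' * x ^+ A * c ^+ A by apply: commutator_expg.
have cAx' : commute (c ^+ A)^-1 x'.
  by apply/commute_sym/commuteV/commuteX/commute_sym.
have x'A : x' * x ^+ A = x ^+ A * x' * (c ^+ A)^-1 by rewrite xA mulgK.
have gh : x ^+ A * x' ^+ j1 = x' ^+ j1 * x ^+ A * (c ^+ A) ^+ j1.
  by rewrite (commutator_expg _ cAx' x'A) expVgn mulgVK.
have cw w k l f : commute c w -> commute ((c ^+ k) ^+ l) (w ^+ f).
  by move=> cw; rewrite -expgnA; apply: commuteX2.
have [k ek] := expgMn_central (p ^ v) (cw _ A j1 A cx) (cw _ A j1 j1 cx') gh.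
have gx' : commute (x' ^+ j1 * x ^+ A) x'.
  apply: (commute_of_root IH x'y (u := v.+1)); last 2 first.
  - by rewrite (leq_trans vu).
  - rewrite expnSr expgnA ek -!expgnA -eA -ej.
    have -> : x' ^+ j * x ^+ i = c / y ^+ M by rewrite {1}eM mulgK.
    have cyM : commute c (y ^+ M)^-1 by apply/commuteV/commuteX.
    rewrite expgMn; last first.
      by apply: commuteX; apply/commute_sym/commuteM => //; apply: commuteV.
    rewrite expgMn // expgnAC cp expg1n mul1g mulg1.
    apply: spanX; exact: subgroupV in_span_subgroup MY.
  - by apply/commute_sym/commuteM; apply/commuteX/commute_sym.
apply: (commute_coprime_root (i := A)) => //.
rewrite -[x ^+ A](mulKg (x' ^+ j1)); apply/commute_sym/commuteM.
  exact/commuteV/commuteX.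
exact/commute_sym.
Qed.

(** Perturbing only [x] forces [q] to divide the exponent of [x], whence [c] is a
power of [x'] up to the span; perturbing only [x'] makes [c] a power of [x] up
to the span.  Hence [c] is central.  The valuations [u] and [t] of the two
exponents are then compared. *)
Lemma commute_step (x x' : G) a b :
    (forall h, h ^+ (p ^ a) = 1 -> commute h x') -> (a <= e)%N ->
    (forall h, h ^+ (p ^ b) = 1 -> commute h x) -> (b <= e)%N ->
    x ^+ (p ^ a.+1) = 1 -> x' ^+ (p ^ b.+1) = 1 ->
    commute x y -> commute x' y -> span_pure x x' ->
  commute x x'.
Proof.
move=> IH ae IH' be xa x'b xy x'y pure.
pose c := x'^-1 * x * x' / x.
have kill (g : G) d k : g ^+ (p ^ d.+1) = 1 -> (d <= e)%N -> q %| k -> g ^+ k = 1.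
  move=> gd de qk; have /dvdnP[l ->] : p ^ d.+1 %| k.
    by apply: dvdn_trans qk; apply: dvdn_exp2l.
  by rewrite mulnC expgnA gd expg1n.
have spanV g : in_span g -> in_span g^-1 by apply: subgroupV in_span_subgroup.
have [i' [j [_ j0 qi' ec']]] := perturbed_commutator 1 0 xy x'y pure.
rewrite -/c mul1n mul0n addn0 in qi' ec'.
rewrite (kill _ _ _ xa ae qi') mulg1 in ec'.
have [i [j' [i0 _ qj' ec]]] := perturbed_commutator 0 1 xy x'y pure.
rewrite -/c mul1n mul0n add0n in qj' ec.
rewrite (kill _ _ _ x'b be qj') mul1g in ec.
have := in_span_exp qi'; have := in_span_exp qj'.
move: (y ^+ i') (y ^+ j') ec ec' => z' z ec ec' zY z'Y.
have cx : commute c x.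
  rewrite ec; apply/commute_sym/commuteM; first exact: commuteX.
  exact: in_span_commute.
have cx' : commute c x'.
  rewrite ec'; apply/commute_sym/commuteM; first exact: commuteX.
  exact: in_span_commute.
have cy : commute c y.
  rewrite ec; apply/commute_sym/commuteM; first exact/commuteX/commute_sym.
  exact: in_span_commute.
have xx' : x * x' = x' * x * c.
  by rewrite -mulgA -cx /c mulgVK !mulgA mulgV mul1g.
have span_c : in_span c -> commute x x'.
  move=> cY; have [k [l [k0 l0 ekl]]] := quasi_commutator x x'.
  exact: (commute_of_span_commutator IH ae IH' be xa x'b xy x'y xx' cY k0 l0 ekl).
have xi : x ^+ i = c / z by rewrite ec mulgK.
have x'j : x' ^+ j = c / z' by rewrite ec' mulgK.
have [A cA eA] := pfactor_coprime p_pr i0; set u := logn p i in eA.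
have [B cB eB] := pfactor_coprime p_pr j0; set t := logn p j in eB.
have [ua|au] := leqP u a; last first.
  apply: span_c; rewrite ec eA -(subnK au) expnD mulnA mulnC expgnA xa expg1n.
  by rewrite mul1g.
have [tb|bt] := leqP t b; last first.
  apply: span_c; rewrite ec' eB -(subnK bt) expnD mulnA mulnC expgnA x'b expg1n.
  by rewrite mul1g.
have xp : commute (x ^+ p) x' by apply: IH; rewrite -expgnA -expnS.
have x'p : commute (x' ^+ p) x by apply: IH'; rewrite -expgnA -expnS.
(* By induction [x ^+ p] commutes with [x'], and their commutator is [c ^+ p]. *)
have cp : c ^+ p = 1.
  apply: (mulgI (x' * x ^+ p)); rewrite -commutator_expg // mulg1; exact: xp.
have zz' : in_span (z' / z) by case/subgroupP: in_span_subgroup => _; apply.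
have z'z : in_span (z / z') by case/subgroupP: in_span_subgroup => _; apply.
(* Both [x ^+ i] and [x' ^+ j] equal [c] up to the span, so their ratio is in it. *)
have [ut|tu|ut] := ltngtP u t.
- apply: (commute_of_span_ratio IH ae xy x'y x'p _ zz' cA ut ua (B := B)).
  by rewrite -eA -eB xi x'j mulgA mulgVK.
- apply/commute_sym.
  apply: (commute_of_span_ratio IH' be x'y xy xp _ z'z cB tu tb (B := A)).
  by rewrite -eA -eB xi x'j mulgA mulgVK.
have root (g w : G) d D : g ^+ (D * p ^ d) = c / w -> in_span w -> coprime p D ->
    exists k, exists2 w', in_span w' & coprime p k /\ g ^+ (p ^ d) = c ^+ k * w'.
  move=> gD wY /(expg_coprime_root g)[k pk gk].
  exists k, (w^-1 ^+ k); first exact: subgroupX in_span_subgroup (spanV _ wY).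
  split=> //; rewrite -{1}gk -expgnA mulnAC expgnA gD expgMn //.
  exact/in_span_commute/cy/spanV.
rewrite eA in xi; rewrite eB -ut in x'j.
have [m [w wY [pm hm]]] := root _ _ _ _ xi zY cA.
have [n [w' w'Y [pn hn]]] := root _ _ _ _ x'j z'Y cB.
have [] // := commute_of_equal_heights IH _ xy x'y pure erefl cx cx' cy xx' cp
  hm wY pm hn w'Y pn.
by rewrite ua.
Qed.

End Adjust.

(** * Elements killed by a fixed power of p *)

(** Centralizers of finite sets contain elements whose order, even modulo a given
finite subgroup, exceeds [p ^ e]. *)
Definition roomy e : Prop := forall F : seq G,
  exists2 y, centralizes y F & y ^+ (p ^ e) \notin F.

Definition torsion_commutes e : Prop := forall x x' : G,
  x ^+ (p ^ e) = 1 -> x' ^+ (p ^ e) = 1 -> commute x x'.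

Lemma finite_powers (g : G) : finite_set (powers g).
Proof.
have [k gk] := expg_pow_eq1 g.
apply: (sub_finite_set (B := (fun n => g ^+ n) @` `I_(p ^ k.+1))).
  move=> _ [n _ <-]; exists (n %% p ^ k.+1)%N.
    by rewrite /= ltn_mod expn_gt0 prime_gt0.
  by rewrite {2}(divn_eq n (p ^ k.+1)) expgnDr mulnC expgnA gk expg1n mul1g.
exact/finite_image/finite_II.
Qed.

(** The group generated by [x] and [x'] is finite, so [y] can be taken with
[y ^+ (p ^ e)] outside it.  If it contained [y ^+ m] with [m] of valuation
[v <= e], it would contain [y ^+ (p ^ v)], which is a power of [y ^+ m], and hence
[y ^+ (p ^ e)]. *)
Lemma exists_span_pure e (x x' : G) : roomy e ->
  exists y, [/\ commute x y, commute x' y & span_pure e y x x'].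
Proof.
move=> room; pose P := prodset (powers x') (powers x).
have sx := powers_subgroup x; have sx' := powers_subgroup x'.
have sP : subgroup P := prodset_subgroup sx' sx (hq sx' sx).
have [s Ps] : exists s : seq G, P = [set` s].
  by apply/finite_seqP; apply: finite_image2; apply: finite_powers.
have [y yF yP] := room [:: x, x' & s].
exists y; split; [exact/yF/mem_head | by apply: yF; rewrite !inE eqxx orbT |].
move=> m Pm; apply: contraNT yP => qm.
have m0 : (0 < m)%N by rewrite lt0n; apply: contraNneq qm => ->.
have [m' cm' em] := pfactor_coprime p_pr m0; set v := logn p m in em.
have ve : (v <= e)%N.
  by rewrite leqNgt; apply: contra qm => ev; rewrite em dvdn_mull // dvdn_exp2l.
have [k _ yk] := expg_coprime_root y cm'.
have : P (y ^+ (p ^ e)).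
  rewrite -(subnKC ve) expnD expgnA; apply: subgroupX => //.
  by rewrite -yk -expgnA mulnAC -em expgnA; apply: subgroupX.
by rewrite Ps /= !inE => ->; rewrite !orbT.
Qed.

(** Induction on the sum of the exponents of the orders of the two elements; the
element [y] is chosen afresh for each pair. *)
Lemma torsion_commutes_step e : roomy e -> torsion_commutes e.+1.
Proof.
move=> room.
have main N : forall a b (x x' : G), (a + b <= N)%N -> (a <= e.+1)%N ->
    (b <= e.+1)%N -> x ^+ (p ^ a) = 1 -> x' ^+ (p ^ b) = 1 -> commute x x'.
  elim: N => [|N IHN] a b x x'; last first.
    case: a => [|a]; last case: b => [|b].
    - by move=> _ _ _; rewrite expn0 expg1 => -> _; exact/commute_sym/commute1.
    - by move=> _ _ _ _; rewrite expn0 expg1 => ->; exact: commute1.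
    rewrite addSn ltnS => abN ae be xa x'b.
    have [y [xy x'y pure]] := exists_span_pure x x' room.
    apply: (commute_step (e := e) (y := y) (a := a) (b := b)) => // h hk.
      by apply: (IHN a b.+1) => //; apply: ltnW.
    apply: (IHN b a.+1) => //; last exact: ltnW.
    by rewrite addnS -addSn addnC.
  rewrite leqn0 addn_eq0 => /andP[/eqP-> _] _ _.
  by rewrite expn0 expg1 => -> _; exact/commute_sym/commute1.
by move=> x x'; apply: (main (e.+1 + e.+1)%N).
Qed.

(** * Finiteness of the derived subgroup *)

(** A product of finitely many finite cyclic subgroups is again a subgroup. *)
Lemma finite_span (s : seq G) : exists H : set G,
  [/\ subgroup H, finite_set H & forall x, x \in s -> H x].
Proof.
elim: s => [|x s [H [sH fH Hs]]].
  exists (powers 1); split=> //; first exact: powers_subgroup.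
  exact: finite_powers.
have sx := powers_subgroup x.
exists (prodset H (powers x)); split.
- exact: prodset_subgroup (hq sH sx).
- by apply: finite_image2 => //; apply: finite_powers.
move=> z; rewrite inE => /orP[/eqP->|/Hs Hz].
  exists 1; first by case/subgroupP: sH.
  by exists x; rewrite ?mul1g //; apply: powers_id.
by exists z => //; exists 1; rewrite ?mulg1 //; case/subgroupP: sx.
Qed.

Lemma derived_finite_of_commutators (S : set G) : finite_set S ->
  (forall a b, S (a * b * a^-1 * b^-1)) -> finite_set (derived G).
Proof.
move=> /finite_seqP[s es] Sab; have [H [sH fH Hs]] := finite_span s.
apply: sub_finite_set fH; apply: smallest_sub => // _ [a _ [b _ <-]].
by apply: Hs; have := Sab a b; rewrite es.
Qed.

(** Write [a = t * w] and [b = s * v] with [w] and [v] in [X].  As [w] and [v]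
commute, the commutator of [w] and [b] is that of [w] and [s], so that of [a] and
[b] is built from [t] and from commutators of [s] with [w] and of [t] with [b];
an element of an FC-group has only finitely many commutators. *)
Lemma derived_finite_of_abelian_cover (T : seq G) (X : set G) :
    FC_group G -> (forall x z, X x -> X z -> commute x z) ->
    (forall g, exists2 t, t \in T & X (t^-1 * g)) ->
  finite_set (derived G).
Proof.
move=> hfc abX cov.
pose D := [set d | exists2 t, t \in T & exists g, d = t * g * t^-1 * g^-1].
have finT : finite_set [set` T] by apply: finite_seq.
have finD : finite_set D.
  apply: (sub_finite_set (B := \bigcup_(t in [set` T])
    [set t * u | u in [set t^-1 ^ g | g in [set: G]]])).
    move=> _ [t tT [g ->]]; exists t => //; exists (t^-1 ^ g^-1).
      by exists g^-1.
    by rewrite conjgE invgK !mulgA.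
  by apply: bigcup_finite => // t _; apply/finite_image/hfc.
pose U := [set t * d^-1 * t^-1 | t in [set` T] & d in D].
apply: (derived_finite_of_commutators (S := [set u * d | u in U & d in D])).
  by do 2?apply: finite_image2.
move=> a b; have [t tT Xa] := cov a; have [s sT Xb] := cov b.
have ea := mulVKg t a; have eb := mulVKg s b.
move: (t^-1 * a) (s^-1 * b) Xa Xb ea eb => w v Xw Xv ea eb.
exists (t * (s * w * s^-1 * w^-1)^-1 * t^-1).
  by exists t => //; exists (s * w * s^-1 * w^-1) => //; exists s => //; exists w.
exists (t * b * t^-1 * b^-1); first by exists t => //; exists b.
have wv := abX _ _ Xw Xv.
have -> : (s * w * s^-1 * w^-1)^-1 = w * b * w^-1 * b^-1.
  rewrite -eb !invgM !invgK !mulgA; congr (_ * _).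
  by rewrite -(mulgA (w * s) v) (commuteV (commute_sym wv)) mulgA mulgK.
by rewrite -ea !invgM !mulgA !mulgVK.
Qed.

(** The centralizer of some finite [F] has all its [p ^ e]-th powers in [F], so by
[centralizer_cover] and [fc_transversal] the whole group is covered by finitely
many translates of the set of elements killed by [p ^ e]. *)
Lemma derived_finite_of_not_roomy e : FC_group G ->
  torsion_commutes e -> ~ roomy e -> finite_set (derived G).
Proof.
move=> hfc tc nroom; pose q := (p ^ e)%N.
have [F hF] : exists F : seq G, forall y, centralizes y F -> y ^+ q \in F.
  apply: contrapT => noF; apply: nroom => F; apply: contrapT => noy; apply: noF.
  by exists F => y yF; apply: contrapT => /negP yq; apply: noy; exists y.
have [|F' [T' cov]] := centralizer_cover (q := q) (W := F) (F := F) (T := [::]).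
  by move=> y /hF yq; left.
have [T hT] := fc_transversal F' hfc.
pose X := [set x : G | x ^+ q = 1].
apply: (derived_finite_of_abelian_cover (T := [seq t * t' | t <- T, t' <- T'])
  (X := X) hfc) => [x z|g]; first exact: tc.
have [t tT /cov[t' t'T' h]] := hT g.
exists (t * t'); last by rewrite /X /= invgM -mulgA.
by apply/allpairsP; exists (t, t').
Qed.

(** If the derived subgroup were infinite, every [roomy e] would hold, so all
elements would commute. *)
Lemma derived_finite_of_FC : FC_group G -> finite_set (derived G).
Proof.
move=> hfc; have [//|infinite] := EM (finite_set (derived G)).
have tc e : torsion_commutes e.
  elim: e => [|e IHe]; last first.
    apply: torsion_commutes_step; apply: contrapT => nroom; apply: infinite.
    exact: derived_finite_of_not_roomy nroom.
  by move=> x x'; rewrite expn0 !expg1 => -> ->.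
apply: (derived_finite_of_commutators (S := [set 1])) => // a b /=.
have [k ak] := expg_pow_eq1 a; have [l bl] := expg_pow_eq1 b.
have ab : commute a b.
  apply: (tc (k.+1 + l.+1)%N).
    by rewrite expnD expgnA ak expg1n.
  by rewrite addnC expnD expgnA bl expg1n.
by rewrite ab mulgK mulgV.
Qed.

End PGroup.

Theorem proposition2p8 (p : nat) (G : groupType) :
  prime p -> quasihamiltonian G -> p_group p G ->
  (FC_group G <-> finite_set (derived G)).
Proof.
move=> p_pr hq hp; split; last exact: FC_of_derived_finite.
exact: (derived_finite_of_FC p_pr hq hp).
Qed.
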